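(* Consider the stochastic Poisson system in $\mathbb{R}^d$ $$dy(t)=B(y(t))\Big(\nabla H_0(y(t))\,dt+\sum_{r=1}^m\nabla H_r(y(t))\circ dW_r(t)\Big),$$ and suppose the structure matrix is constant, $B(y)\equiv B$. Then the diagonal implicit Runge-Kutta methods preserve the Poisson structure: for every diagonal implicit Runge-Kutta method, the one-step map $y_k\mapsto y_{k+1}$ satisfies $$\frac{\partial y_{k+1}}{\partial y_k}\,B\left(\frac{\partial y_{k+1}}{\partial y_k}\right)^\top=B\qquad\text{for all }k,\ \text{almost surely}.$$
   Context: $H_0,\dots,H_m:\mathbb{R}^d\to\mathbb{R}$ are smooth; $B\in\mathbb{R}^{d\times d}$ is a constant skew-symmetric matrix; $W=(W_1,\dots,W_m)$ is an $m$-dimensional standard Wiener process; $\circ$ is the Stratonovich product. Diagonal implicit Runge-Kutta method with $s$ stages: given real weights $b_i^l$ ($i=1,\dots,s$, $l=0,\dots,m$) with $\sum_{i=1}^s b_i^l=1$ for each $l$, set $a_{ij}^l=b_j^l$ if $i>j$, $a_{ii}^l=\frac12 b_i^l$, $a_{ij}^l=0$ if $i<j$. With $f_l(y)=B\nabla H_l(y)$, time step $h>0$ and increments $J_k^r=W_r(t_{k+1})-W_r(t_k)$, the step $y_k\mapsto y_{k+1}$ is $$Y_i=y_k+h\sum_{j=1}^sa_{ij}^0f_0(Y_j)+\sum_{r=1}^m\sum_{j=1}^sa_{ij}^rf_r(Y_j)J_k^r,\quad i=1,\dots,s,$$ $$y_{k+1}=y_k+h\sum_{i=1}^sb_i^0f_0(Y_i)+\sum_{r=1}^m\sum_{i=1}^sb_i^rf_r(Y_i)J_k^r.$$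 Everything is understood pathwise, for fixed realizations of the increments $J_k^r$. It is understood that the implicit stage equations are solvable, with the stages $Y_1,\dots,Y_s$ (hence $y_{k+1}$) being differentiable functions of $y_k$ on the open set of $y_k$ considered; $\frac{\partial y_{k+1}}{\partial y_k}$ denotes the Jacobian matrix of the resulting one-step map. *)

(* Defs.v *)
From HB Require Import structures.
From mathcomp Require Import all_boot all_order all_algebra.
From mathcomp Require Import all_classical all_reals all_analysis.

Set Implicit Arguments.
Unset Strict Implicit.
Unset Printing Implicit Defensive.

Import Order.TTheory GRing.Theory Num.Theory.
Import numFieldNormedType.Exports.

Local Open Scope classical_set_scope.
Local Open Scope ring_scope.

(* Points of R^d are row vectors, since [jacobian] of MathComp-Analysis is
   stated for maps between row vectors.  Gradients are column vectors. *)

Section Calculus.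
Context {R : realType} {d : nat}.

Definition grad (f : 'rV[R]_d -> R) (y : 'rV[R]_d) : 'cV[R]_d :=
  \col_i 'D_(delta_mx 0 i) f y.

Fixpoint Ck (k : nat) (f : 'rV[R]_d -> R) : Prop :=
  if k is k'.+1 then
    (forall y, differentiable f y) /\
    (forall i : 'I_d, Ck k' (fun y => 'D_(delta_mx 0 i) f y))
  else continuous f.

Definition smooth (f : 'rV[R]_d -> R) : Prop := forall k, Ck k f.

(* [jacobian phi y] acts on row vectors from the right, so its (i, j) entry is
   the derivative of the j-th component of phi along the i-th coordinate; the
   usual Jacobian matrix d(phi)_i / d(y)_j is its transpose. *)
Definition jacobian_matrix (phi : 'rV[R]_d -> 'rV[R]_d) (y : 'rV[R]_d) :
    'M[R]_d := (jacobian phi y)^T.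

End Calculus.

Section WienerProcess.
Context {disp : measure_display} {T : measurableType disp} {R : realType}.
Variable P : probability T R.

(* As the A i may be the full space, the product rule for the whole finite
   family contains the product rule for all its subfamilies. *)
Definition mutually_independent (I : finType) (X : I -> T -> R) : Prop :=
  forall A : I -> set R, (forall i, measurable (A i)) ->
    P (\bigcap_(i in [set: I]) (X i @^-1` A i)) =
    (\prod_(i : I) P (X i @^-1` A i))%E.

(* Only the times t >= 0 matter.  The increments are jointly independent over
   both the time intervals and the components.  The second argument of
   [normal_prob] is the standard deviation. *)
Record standard_wiener_process (m : nat) (W : 'I_m -> R -> {RV P >-> R}) :
    Prop := StandardWienerProcess {
  wiener_start : {ae P, forall w, forall r, W r 0 w = 0};
  wiener_independent_increments : forall (n : nat) (t : nat -> R),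
    0 <= t 0%N -> (forall i, t i < t i.+1) ->
    mutually_independent (fun (ri : 'I_m * 'I_n) w =>
      W ri.1 (t ri.2.+1) w - W ri.1 (t ri.2) w);
  wiener_gaussian_increments : forall (r : 'I_m) (s t : R),
    0 <= s -> s < t -> forall A : set R, measurable A ->
    P ((fun w => W r t w - W r s w) @^-1` A) =
    normal_prob 0 (Num.sqrt (t - s)) A;
  wiener_continuous_paths : {ae P, forall w, forall r,
    {within `[0, +oo[, continuous (fun t : R => W r t w)}}
}.

End WienerProcess.

(* The index l = 0 in 'I_m.+1 is the drift, and the noise index r in 'I_m is
   l = lift ord0 r, that is, r + 1. *)
Section DiagonalImplicitRungeKutta.
Context {R : realType} {d m s : nat}.
Variables (B : 'M[R]_d) (H : 'I_m.+1 -> 'rV[R]_d -> R).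
Variable b : 'I_m.+1 -> 'I_s -> R.
Variables (h : R) (J : 'I_m -> R).

Definition dirk_coef (l : 'I_m.+1) (i j : 'I_s) : R :=
  if (j < i)%N then b l j else if j == i then 2^-1 * b l i else 0.

Definition poisson_field (l : 'I_m.+1) (y : 'rV[R]_d) : 'rV[R]_d :=
  (B *m grad (H l) y)^T.

Definition dirk_stage_equations (y : 'rV[R]_d) (Y : 'I_s -> 'rV[R]_d) : Prop :=
  forall i : 'I_s,
    Y i = y + h *: (\sum_(j < s) dirk_coef ord0 i j *: poisson_field ord0 (Y j))
            + \sum_(r < m) \sum_(j < s)
                (dirk_coef (lift ord0 r) i j * J r) *:
                  poisson_field (lift ord0 r) (Y j).

Definition dirk_update (y : 'rV[R]_d) (Y : 'I_s -> 'rV[R]_d) : 'rV[R]_d :=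
  y + h *: (\sum_(i < s) b ord0 i *: poisson_field ord0 (Y i))
    + \sum_(r < m) \sum_(i < s)
        (b (lift ord0 r) i * J r) *: poisson_field (lift ord0 r) (Y i).

End DiagonalImplicitRungeKutta.

(* Main.v *)
Require Import Defs.
From HB Require Import structures.
From mathcomp Require Import all_boot all_order all_algebra.
From mathcomp Require Import all_classical all_reals all_analysis.
From mathcomp Require Import ring lra.

(** Put Z_0 = y and let Z_j be y plus the increments of the first j stages.
    The diagonally implicit coefficients say that Y_j is the midpoint of
    Z_{j-1} and Z_j, so each stage is an implicit midpoint step for a single
    Hamiltonian K_j.  Its linearization is the Cayley transform of B S_j / 2
    with S_j the Hessian of K_j, which preserves B since B is skew and S_j is
    symmetric; the Jacobian of the full step is a product of such factors.
    [jacobian] acts on row vectors, so all matrices below appear transposed. *)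

Set Implicit Arguments.
Unset Strict Implicit.
Unset Printing Implicit Defensive.

Import Order.TTheory GRing.Theory Num.Theory.
Import numFieldNormedType.Exports.

Local Open Scope classical_set_scope.
Local Open Scope ring_scope.

(** * Matrix algebra of implicit midpoint steps *)

(** The explicit inverse is [1 - C (1 + A C)^-1 A]. *)
Lemma unitmx_1D_swap (F : comUnitRingType) (m n : nat)
    (A : 'M[F]_(m, n)) (C : 'M[F]_(n, m)) :
  1%:M + A *m C \in unitmx -> 1%:M + C *m A \in unitmx.
Proof.
move=> uAC.
suff /mulmx1_unit[] : (1%:M + C *m A) *m
    (1%:M - C *m invmx (1%:M + A *m C) *m A) = 1%:M by [].
rewrite mulmxBr mulmx1 mulmxDl mul1mx.
have -> : C *m A *m (C *m invmx (1%:M + A *m C) *m A) =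
    C *m ((A *m C) *m invmx (1%:M + A *m C)) *m A by rewrite !mulmxA.
have -> : A *m C *m invmx (1%:M + A *m C) = 1%:M - invmx (1%:M + A *m C).
  apply: (canRL (addrK _)).
  by rewrite -[X in _ + X]mul1mx -mulmxDl addrC mulmxV.
by rewrite mulmxBr mulmxBl mulmx1 [X in _ - X]addrC subrK addrK.
Qed.

(* Eliminating A exhibits Q as P times the Cayley transform of S *m B / 2,
   which preserves B because B *m (1 + S *m B / 2) = (1 + B *m S / 2) *m B.
   Invertibility is carried along: B itself may be singular. *)
Lemma midpoint_step (F : fieldType) (d : nat) (B S A P Q : 'M[F]_d) :
  B^T = - B -> S^T = S ->
  P = A - 2^-1 *: (A *m S *m B^T) -> Q = A + 2^-1 *: (A *m S *m B^T) ->
  P \in unitmx -> P^T *m B *m P = B ->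
  Q \in unitmx /\ Q^T *m B *m Q = B.
Proof.
move=> Bskew Ssym eP eQ uP PBP.
pose N := 2^-1 *: S.
have Nsym : N^T = N by rewrite /N linearZ /= Ssym.
(* Since [B^T = - B], the factors turn into [P = A *m U] and [Q = A *m V]. *)
pose U := 1%:M + N *m B; pose V := 1%:M - N *m B.
have PU : P = A *m U.
  by rewrite eP /U /N Bskew mulmxN scalerN opprK mulmxDr mulmx1 -scalemxAl
    -scalemxAr mulmxA.
have QV : Q = A *m V.
  by rewrite eQ /V /N Bskew mulmxN scalerN mulmxBr mulmx1 -scalemxAl
    -scalemxAr mulmxA.
move: uP; rewrite PU unitmx_mul => /andP[uA uU].
have UT : U^T = 1%:M - B *m N.
  by rewrite /U linearD /= trmx1 trmx_mul Nsym Bskew mulNmx.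
have VT : V^T = 1%:M + B *m N.
  by rewrite /V linearB /= trmx1 trmx_mul Nsym Bskew mulNmx opprK.
(* [V^T = 1 + B *m N] is [U = 1 + N *m B] with the two factors swapped. *)
have uV : V \in unitmx by rewrite -unitmx_tr VT unitmx_1D_swap.
have uUT : U^T \in unitmx by rewrite unitmx_tr.
have VTB : V^T *m B = B *m U.
  by rewrite VT /U mulmxDl mulmxDr mul1mx mulmx1 mulmxA.
have UTB : U^T *m B = B *m V.
  by rewrite UT /V mulmxBl mulmxBr mul1mx mulmx1 mulmxA.
have UVT : U^T *m V^T = V^T *m U^T.
  by rewrite UT VT mulmxBl mulmxBr mul1mx mulmx1 mulmxDl mulmxDr mul1mx mulmx1.
split; first by rewrite QV unitmx_mul uA.
have E : U^T *m (A^T *m B *m A) *m U = B.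
  by rewrite -[RHS]PBP PU trmx_mul !mulmxA.
have XB : A^T *m B *m A = invmx U^T *m B *m invmx U.
  by rewrite -[X in _ = _ *m X *m _]E -!mulmxA mulKmx // mulmxV ?mulmx1.
have iUVT : invmx U^T *m V^T = V^T *m invmx U^T.
  by rewrite -[RHS](mulKmx uUT); congr (_ *m _); rewrite mulmxA UVT mulmxK.
have -> : Q^T *m B *m Q = V^T *m (A^T *m B *m A) *m V.
  by rewrite QV trmx_mul !mulmxA.
(* Once [V^T] has moved past [invmx U^T], [VTB] produces a [U] that cancels [invmx U], and [UTB]
   then cancels [invmx U^T]. *)
rewrite XB !mulmxA -iUVT -(mulmxA (invmx U^T)) VTB mulmxA mulmxK //.
by rewrite -mulmxA -UTB mulKmx.
Qed.

(** The factor of [b l j] in [dirk_coef]. It does not depend on [l], so drift and noise can be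
    merged into one Hamiltonian per stage. *)
Definition dirk_weight (F : fieldType) (s : nat) (i j : 'I_s) : F :=
  if (j < i)%N then 1 else if j == i then 2^-1 else 0.

(** Here [A i] stands for the transposed Jacobian of stage [i] and [S i] for the Hessian of its
    Hamiltonian. Induction over the partial sums [P k], the transposed Jacobians of Z_k, applies
    [midpoint_step] once per stage. *)
Lemma dirk_jacobian_preserves (F : realFieldType) (d s : nat) (B : 'M[F]_d)
    (A S : 'I_s -> 'M[F]_d) :
  B^T = - B -> (forall j, (S j)^T = S j) ->
  (forall i, A i =
     1%:M + \sum_(j < s) dirk_weight F i j *: (A j *m (S j *m B^T))) ->
  let G := 1%:M + \sum_(j < s) A j *m (S j *m B^T) in G^T *m B *m G = B.
Proof.
move=> Bskew Ssym eqA G.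
pose M j := A j *m (S j *m B^T).
pose P k := 1%:M + \sum_(j < s | (j < k)%N) M j.
(* With [PS] below, this makes [A i] the midpoint of [P i] and [P i.+1]; stages are counted from
   0. *)
have {}eqA i : A i = P i + 2^-1 *: M i.
  rewrite eqA /P -addrA; congr (_ + _).
  rewrite (bigID (fun j : 'I_s => (j < i)%N)) /=; congr (_ + _).
    by apply: eq_bigr => j ji; rewrite /dirk_weight ji scale1r.
  rewrite (bigD1 i) ?ltnn //= /dirk_weight ltnn eqxx big1 ?addr0 // => j.
  by case/andP=> /negbTE-> /negbTE->; rewrite scale0r.
have PS (i : 'I_s) : P i.+1 = P i + M i.
  rewrite /P -addrA; congr (_ + _); rewrite (bigD1 i) //= addrC.
  by congr (_ + _); apply: eq_bigl => j; rewrite ltnS ltn_neqAle andbC.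
have Pinv k : (k <= s)%N -> P k \in unitmx /\ (P k)^T *m B *m P k = B.
  elim: k => [_|k IHk ks].
    rewrite /P big1 // addr0 unitmx1.
    by split=> //; rewrite trmx1 mul1mx mulmx1.
  have [uP PBP] := IHk (ltnW ks).
  pose i := Ordinal ks.
  apply: (@midpoint_step _ _ B (S i) (A i) (P k)) => //.
    by rewrite -mulmxA -/(M i) eqA addrK.
  by rewrite -mulmxA -/(M i) eqA -addrA -scalerDl (PS i);
    congr (_ + _); rewrite -[LHS]scale1r; congr (_ *: _); lra.
have -> : G = P s.
  by rewrite /G /P; congr (_ + _); apply: eq_bigl => j; rewrite ltn_ord.
by have [] := Pinv s (leqnn s).
Qed.

(** * Symmetry of second derivatives *)

Section Calculus.
Variable R : realType.

Lemma is_derive_line (V : normedModType R) (f : V -> R) (a u : V) (s : R) :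
  derivable f (a + s *: u) u ->
  is_derive s 1 (fun r : R => f (a + r *: u)) ('D_u f (a + s *: u)).
Proof.
have E : (fun r : R => r^-1 *: (f (a + (r *: 1 + s) *: u) - f (a + s *: u))) =
         (fun r : R => r^-1 *: (f (r *: u + (a + s *: u)) - f (a + s *: u))).
  apply/funext => r; congr (_ *: (f _ - _)).
  by rewrite scaler1 scalerDl addrCA.
by move=> df; split; rewrite /derivable /derive /= E.
Qed.

Lemma MVT_line (V : normedModType R) (f : V -> R) (a u : V) (t : R) :
  0 < t -> (forall x, derivable f x u) ->
  exists2 s, 0 < s < t & f (a + t *: u) - f a = 'D_u f (a + s *: u) * t.
Proof.
move=> t0 df.
have [||s] := @MVT R (fun r => f (a + r *: u))
  (fun r => 'D_u f (a + r *: u)) 0 t t0.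
- by move=> s _; apply: is_derive_line.
- apply: derivable_within_continuous => s _.
  by case: (is_derive_line (df (a + s *: u))).
- rewrite in_itv /= => st; rewrite scale0r addr0 subr0 => E.
  by exists s.
Qed.

(** The mean value theorem is used twice: along [u] for the first difference [g], then along [v] for
    ['D_u f]. *)
Lemma second_difference (V : normedModType R) (f : V -> R) (x u v : V) (t : R) :
  0 < t -> (forall y, derivable f y u) -> (forall y, derivable ('D_u f) y v) ->
  exists s r, [/\ 0 < s < t, 0 < r < t &
    f (x + t *: u + t *: v) - f (x + t *: u) - f (x + t *: v) + f x =
    'D_v ('D_u f) (x + s *: u + r *: v) * t * t].
Proof.
move=> t0 df ddf.
pose g y := f (y + t *: v) - f y.
have dfs y : is_derive y u (fun z => f (z + t *: v)) ('D_u f (y + t *: v)).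
  have E : (fun r : R => r^-1 *: (f (r *: u + y + t *: v) - f (y + t *: v))) =
           (fun r : R => r^-1 *: (f (r *: u + (y + t *: v)) - f (y + t *: v))).
    by apply/funext => r; rewrite addrA.
  by split; rewrite /derivable /derive /= E //; apply: df.
have dg y : is_derive y u g ('D_u f (y + t *: v) - 'D_u f y).
  by apply: is_deriveB; apply: derivableP.
have [s st Es] := MVT_line x t0 (fun y => @ex_derive _ _ _ _ _ _ _ (dg y)).
have [r rt Er] := MVT_line (x + s *: u) t0 ddf.
exists s, r; split=> //; rewrite -Er -(@derive_val _ _ _ _ _ _ _ (dg _)) -Es /g.
ring.
Qed.

(** The second difference is symmetric in [u] and [v]. Divided by [t * t], it is a value of each
    mixed derivative at a point near [x]; continuity then lets both points tend to [x]. *)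
Lemma schwarz_mixed_derivatives (V : normedModType R) (f : V -> R) (x u v : V) :
  (forall y, derivable f y u) -> (forall y, derivable f y v) ->
  (forall y, derivable ('D_u f) y v) -> (forall y, derivable ('D_v f) y u) ->
  {for x, continuous ('D_v ('D_u f))} -> {for x, continuous ('D_u ('D_v f))} ->
  'D_v ('D_u f) x = 'D_u ('D_v f) x.
Proof.
move=> dfu dfv dfuv dfvu cuv cvu.
apply/eqP; rewrite -subr_eq0 -normr_le0; apply/ler_addgt0Pl => e e0; rewrite addr0.
have dist_split (a b c c' : R) : c = c' ->
    `|a - c| < e / 2 -> `|b - c'| < e / 2 -> `|a - b| <= e.
  move=> <- ac bc; rewrite -(subrKA c) (le_trans (ler_normD _ _)) //.
  by rewrite [leRHS]splitr lerD ?ltW // distrC.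
have e20 : 0 < e / 2 by rewrite divr_gt0.
have /nbhs_normP[d1 d10 B1] := (cvgrPdist_lt (FF := nbhs_filter x) _ _).1 cuv _ e20.
have /nbhs_normP[d2 d20 B2] := (cvgrPdist_lt (FF := nbhs_filter x) _ _).1 cvu _ e20.
(* The summand 1 keeps [M] positive even if [u] and [v] vanish; the choice [t = d / M] gives
   [t * (|u| + |v|) < d]. *)
pose M := `|u| + `|v| + 1.
have M0 : 0 < M by rewrite ltr_wpDl // addr_ge0.
pose d := Num.min d1 d2.
have d0 : 0 < d by rewrite lt_min; apply/andP.
have d_le1 : d <= d1 by rewrite ge_min lexx.
have d_le2 : d <= d2 by rewrite ge_min lexx orbT.
pose t := d / M.
have t0 : 0 < t by rewrite divr_gt0.
have near_x s r : 0 < s < t -> 0 < r < t -> `|x - (x + s *: u + r *: v)| < d.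
  move=> /andP[s0 st] /andP[r0 rt].
  rewrite -addrA opprD addNKr normrN.
  rewrite (le_lt_trans (ler_normD _ _)) // !normrZ !gtr0_norm //.
  rewrite (@le_lt_trans _ _ (t * (`|u| + `|v|))) //.
    by rewrite mulrDr lerD // ler_wpM2r // ltW.
  by rewrite -[ltRHS](divfK (lt0r_neq0 M0)) ltr_pM2l // ltrDl.
have [s1 [r1 [s1t r1t E1]]] := second_difference x t0 dfu dfuv.
have [s2 [r2 [s2t r2t E2]]] := second_difference x t0 dfv dfvu.
have E : 'D_v ('D_u f) (x + s1 *: u + r1 *: v) =
         'D_u ('D_v f) (x + s2 *: v + r2 *: u).
  apply/(mulIf (lt0r_neq0 t0))/(mulIf (lt0r_neq0 t0)).
  apply: etrans (esym E1) (etrans _ E2).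
  congr (_ + _); apply: etrans (addrAC _ _ _) _.
  by congr (f _ - _ - _); exact: addrAC.
have N1 : `|'D_v ('D_u f) x - 'D_v ('D_u f) (x + s1 *: u + r1 *: v)| < e / 2.
  apply: B1; rewrite /= /ball_ /=.
  exact: lt_le_trans (near_x _ _ s1t r1t) d_le1.
have N2 : `|'D_u ('D_v f) x - 'D_u ('D_v f) (x + s2 *: v + r2 *: u)| < e / 2.
  apply: B2; rewrite /= /ball_ /= (addrAC x).
  exact: lt_le_trans (near_x _ _ r2t s2t) d_le2.
exact: dist_split E N1 N2.
Qed.

End Calculus.

(** * Rules for Jacobians acting on row vectors *)

Section Jacobian.
Variables (R : realType) (d : nat).
Implicit Types (f g : 'rV[R]_d -> 'rV[R]_d) (x : 'rV[R]_d).

Lemma row_jacobian f x (i : 'I_d) :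
  differentiable f x -> row i (jacobian f x) = 'D_(delta_mx 0 i) f x.
Proof. by move=> df; rewrite deriveEjacobian // rowE. Qed.

(** Lets an equation that holds only on a neighbourhood, such as a stage equation, be
    differentiated. *)
Lemma jacobian_near f g x :
  differentiable f x -> differentiable g x -> (\near x, f x = g x) ->
  jacobian f x = jacobian g x.
Proof.
move=> df dg fg; apply/row_matrixP => i.
apply: etrans (row_jacobian i df) (etrans _ (esym (row_jacobian i dg))).
exact: near_eq_derive.
Qed.

Lemma jacobian_comp f g x :
  differentiable f x -> differentiable g (f x) ->
  jacobian (g \o f) x = jacobian f x *m jacobian g (f x).
Proof.
move=> df dg; apply/row_matrixP => i.
rewrite row_jacobian; last exact: differentiable_comp.
rewrite deriveE; last exact: differentiable_comp.
rewrite diff_comp //= row_mul row_jacobian //.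
apply: etrans (deriveEjacobian _ dg); apply: etrans (esym (deriveE _ dg)).
by congr ('d g _ _); apply/esym/deriveE.
Qed.

Lemma jacobian_id x : jacobian id x = 1%:M.
Proof.
apply/row_matrixP => i.
by rewrite row_jacobian // derive_id row1.
Qed.

Lemma jacobianD f g x : differentiable f x -> differentiable g x ->
  jacobian (f + g) x = jacobian f x + jacobian g x.
Proof.
move=> df dg; apply/row_matrixP => i.
apply: etrans (row_jacobian i (differentiableD df dg)) _.
apply: etrans (deriveD (diff_derivable df) (diff_derivable dg)) _.
apply: etrans (esym (raddfD (row i) _ _)).
by congr (_ + _); apply/esym/row_jacobian.
Qed.

Lemma jacobianZ (k : R) f x : differentiable f x ->
  jacobian (k *: f) x = k *: jacobian f x.
Proof.
move=> df; apply/row_matrixP => i.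
apply: etrans (row_jacobian i (differentiableZ k df)) _.
apply: etrans (deriveZ k (diff_derivable df)) _.
rewrite [RHS]linearZ /=.
by congr (_ *: _); apply/esym/row_jacobian.
Qed.

Lemma jacobian_sum n (f : 'I_n -> 'rV[R]_d -> 'rV[R]_d) x :
  (forall j, differentiable (f j) x) ->
  jacobian (fun y => \sum_(j < n) f j y) x = \sum_(j < n) jacobian (f j) x.
Proof.
move=> df; apply/row_matrixP => i.
have -> : (fun y => \sum_(j < n) f j y) = \sum_(j < n) f j.
  by apply/funext => y; rewrite fct_sumE.
rewrite row_jacobian; last exact: differentiable_sum.
rewrite raddf_sum /= derive_sum => [|j]; last exact: diff_derivable.
by apply: eq_bigr => j _; rewrite row_jacobian.
Qed.

End Jacobian.

(** * Hessians and the linearized Poisson vector fields *)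

Section PoissonField.
Variables (R : realType) (d m : nat).
Variables (B : 'M[R]_d) (H : 'I_m.+1 -> 'rV[R]_d -> R).
Hypothesis H_smooth : forall l, smooth (H l).

Definition hessian (f : 'rV[R]_d -> R) (y : 'rV[R]_d) : 'M[R]_d :=
  \matrix_(i, j) 'D_(delta_mx 0 i) ('D_(delta_mx 0 j) f) y.

Lemma hessian_sym (f : 'rV[R]_d -> R) y :
  smooth f -> (hessian f y)^T = hessian f y.
Proof.
move=> smooth_f; apply/matrixP => i j; rewrite !mxE.
(* Order 2 provides differentiable first and continuous second partial derivatives, as the Schwarz
   theorem requires. *)
have [df ddf] := smooth_f 2.
have d2f i' : forall z, differentiable ('D_(delta_mx 0 i') f) z.
  by have [] := ddf i'.
have cf i' j' : continuous ('D_(delta_mx 0 j') ('D_(delta_mx 0 i') f)).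
  by have [_] := ddf i'; apply.
by apply: schwarz_mixed_derivatives => [z|z|z|z||];
  [exact: diff_derivable.. | exact: cf | exact: cf].
Qed.

(** Scalar functions times constant rows: differentiating the field reduces to differentiating the
    partial derivatives of [H l]. *)
Lemma poisson_fieldE l y : poisson_field B H l y =
  \sum_(j < d) 'D_(delta_mx 0 j) (H l) y *: (col j B)^T.
Proof.
apply/rowP => i; rewrite summxE !mxE; apply: eq_bigr => j _.
by rewrite !mxE mulrC.
Qed.

Lemma differentiable_poisson_field l y :
  differentiable (poisson_field B H l) y.
Proof.
have [_ ddf] := H_smooth l 2.
have -> : poisson_field B H l =
    \sum_(j < d) (fun z => 'D_(delta_mx 0 j) (H l) z *: (col j B)^T).
  by apply/funext => z; rewrite poisson_fieldE fct_sumE.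
apply: differentiable_sum => j; apply: differentiableZl.
by have [] := ddf j.
Qed.

Lemma jacobian_poisson_field l y :
  jacobian (poisson_field B H l) y = hessian (H l) y *m B^T.
Proof.
have [_ ddf] := H_smooth l 2.
have d2f j : differentiable ('D_(delta_mx 0 j) (H l)) y by have [] := ddf j.
have eqF : poisson_field B H l =
    (fun z => \sum_(j < d) 'D_(delta_mx 0 j) (H l) z *: (col j B)^T).
  by apply/funext => z; rewrite poisson_fieldE.
rewrite eqF jacobian_sum => [|j]; last exact: differentiableZl.
apply/row_matrixP => i; rewrite raddf_sum /= row_mul.
apply/rowP => k; rewrite summxE !mxE; apply: eq_bigr => j _.
rewrite row_jacobian; last exact: differentiableZl.
rewrite deriveE; last exact: differentiableZl.
by rewrite diffZl // !mxE deriveE.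
Qed.

End PoissonField.

(** * Differentiation of the Runge-Kutta step *)

Section OneStep.
Variables (R : realType) (d m s : nat).
Variables (B : 'M[R]_d) (H : 'I_m.+1 -> 'rV[R]_d -> R).
Hypothesis H_smooth : forall l, smooth (H l).
Variables (b : 'I_m.+1 -> 'I_s -> R) (h : R) (J : 'I_m -> R).

(** The time step acts as the increment of index 0, which treats drift and noise alike. *)
Definition increment (l : 'I_m.+1) : R :=
  if unlift ord0 l is Some r then J r else h.

(** The field [B] grad K_j of the stage Hamiltonian K_j, the sum over [l] of [increment l * b l j]
    times [H l]; [stage_hessian] is the Hessian of K_j. *)
Definition stage_field (j : 'I_s) (y : 'rV[R]_d) : 'rV[R]_d :=
  \sum_(l < m.+1) (increment l * b l j) *: poisson_field B H l y.

Definition stage_hessian (j : 'I_s) (y : 'rV[R]_d) : 'M[R]_d :=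
  \sum_(l < m.+1) (increment l * b l j) *: hessian (H l) y.

Lemma stage_hessian_sym j y : (stage_hessian j y)^T = stage_hessian j y.
Proof.
rewrite /stage_hessian raddf_sum; apply: eq_bigr => l _.
by rewrite /= linearZ /= hessian_sym.
Qed.

Lemma differentiable_stage_field j y : differentiable (stage_field j) y.
Proof.
have -> : stage_field j =
    \sum_(l < m.+1) (increment l * b l j) *: poisson_field B H l.
  by apply/funext => z; rewrite /stage_field fct_sumE.
apply: differentiable_sum => l; apply: differentiableZ.
exact: differentiable_poisson_field.
Qed.

Lemma jacobian_stage_field j y :
  jacobian (stage_field j) y = stage_hessian j y *m B^T.
Proof.
have dpf l := @differentiable_poisson_field R d m B H H_smooth l y.
apply: etrans (jacobian_sum (f := fun l => (increment l * b l j) *: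
  poisson_field B H l) (fun l => differentiableZ _ (dpf l))) _.
rewrite /stage_hessian mulmx_suml; apply: eq_bigr => l _.
rewrite -scalemxAl -jacobian_poisson_field //.
exact: jacobianZ.
Qed.

(** The weights [th] cover both uses: [dirk_weight R i] gives stage [i], and the constant 1 gives
    the update. *)
Lemma sum_stage_field (th : 'I_s -> R) (y : 'rV[R]_d) (Y : 'I_s -> 'rV[R]_d) :
  y + h *: (\sum_(j < s) (th j * b ord0 j) *: poisson_field B H ord0 (Y j))
    + \sum_(r < m) \sum_(j < s) (th j * b (lift ord0 r) j * J r) *:
        poisson_field B H (lift ord0 r) (Y j) =
  y + \sum_(j < s) th j *: stage_field j (Y j).
Proof.
rewrite -addrA; congr (_ + _).
under [RHS]eq_bigr => j _ do rewrite /stage_field scaler_sumr big_ord_recl.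
rewrite big_split /=; congr (_ + _).
  rewrite scaler_sumr; apply: eq_bigr => j _.
  by rewrite /increment unlift_none !scalerA mulrCA.
rewrite exchange_big /=; apply: eq_bigr => j _; apply: eq_bigr => r _.
by rewrite /increment liftK scalerA -mulrA [b _ _ * _]mulrC.
Qed.

Lemma dirk_coefE l i j : dirk_coef b l i j = dirk_weight R i j * b l j.
Proof.
rewrite /dirk_coef /dirk_weight; case: ifP => _; first by rewrite mul1r.
by case: eqP => [->|_] //; rewrite mul0r.
Qed.

Section Jacobian.
Variables (Y : 'I_s -> 'rV[R]_d -> 'rV[R]_d) (th : 'I_s -> R) (y : 'rV[R]_d).
Hypothesis dY : forall j, differentiable (Y j) y.

(** A sum of functions, convertible to the map in [differentiable_stage_sum], so that
    [differentiableD] applies. *)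
Let Phi : 'rV[R]_d -> 'rV[R]_d :=
  id + (fun z => \sum_(j < s) (th j *: (stage_field j \o Y j)) z).

Let differentiable_stage j : differentiable (stage_field j \o Y j) y.
Proof.
apply: differentiable_comp; [exact: dY | exact: differentiable_stage_field].
Qed.

Let differentiable_stages :
  differentiable (fun z => \sum_(j < s) (th j *: (stage_field j \o Y j)) z) y.
Proof.
have -> : (fun z => \sum_(j < s) (th j *: (stage_field j \o Y j)) z) =
    \sum_(j < s) th j *: (stage_field j \o Y j).
  by apply/funext => z; rewrite fct_sumE.
by apply: differentiable_sum => j; apply: differentiableZ.
Qed.

Lemma differentiable_stage_sum :
  differentiable (fun z => z + \sum_(j < s) th j *: stage_field j (Y j z)) y.
Proof. by have : differentiable Phi y by apply: differentiableD. Qed.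

Lemma jacobian_stage_sum :
  jacobian (fun z => z + \sum_(j < s) th j *: stage_field j (Y j z)) y =
  1%:M + \sum_(j < s) th j *:
    (jacobian (Y j) y *m (stage_hessian j (Y j y) *m B^T)).
Proof.
have did : differentiable (id : 'rV[R]_d -> 'rV[R]_d) y by [].
apply: etrans (jacobianD did differentiable_stages) _.
rewrite jacobian_id; congr (_ + _).
apply: etrans (jacobian_sum (fun j => differentiableZ _
  (differentiable_stage j))) _.
apply: eq_bigr => j _.
apply: etrans (jacobianZ _ (differentiable_stage j)) _; congr (_ *: _).
rewrite -jacobian_stage_field; apply: jacobian_comp; first exact: dY.
exact: differentiable_stage_field.
Qed.

End Jacobian.

(** Differentiating the implicit stage equations gives linear relations among the stage Jacobians,
    which [dirk_jacobian_preserves] takes as they are, without solving for them. *)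
Lemma dirk_step_poisson (U : set 'rV[R]_d)
    (Y : 'I_s -> 'rV[R]_d -> 'rV[R]_d) (y : 'rV[R]_d) :
  B^T = - B -> open U ->
  (forall z, U z -> dirk_stage_equations B H b h J z (Y ^~ z)) ->
  (forall i z, U z -> differentiable (Y i) z) -> U y ->
  let step := fun z => dirk_update B H b h J z (Y ^~ z) in
  jacobian_matrix step y *m B *m (jacobian_matrix step y)^T = B.
Proof.
move=> Bskew oU stageY dY Uy step.
have dYy j : differentiable (Y j) y by exact: dY.
have eqstep : step = fun z => z + \sum_(j < s) 1 *: stage_field j (Y j z).
  apply/funext => z; rewrite -(sum_stage_field (fun=> 1)) /step /dirk_update.
  congr (_ + _ *: _ + _); first by apply: eq_bigr => j _; rewrite mul1r.
  by apply: eq_bigr => r _; apply: eq_bigr => j _; rewrite mul1r.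
have eqY i z : U z ->
    Y i z = z + \sum_(j < s) dirk_weight R i j *: stage_field j (Y j z).
  move=> /stageY /(_ i) ->; rewrite -sum_stage_field.
  congr (_ + _ *: _ + _); first by apply: eq_bigr => j _; rewrite dirk_coefE.
  by apply: eq_bigr => r _; apply: eq_bigr => j _; rewrite dirk_coefE.
have eqA i : jacobian (Y i) y = 1%:M + \sum_(j < s) dirk_weight R i j *:
    (jacobian (Y j) y *m (stage_hessian j (Y j y) *m B^T)).
  apply: etrans (jacobian_stage_sum _ dYy).
  (* The stage equations hold on [U] only; as [U] is open, they hold near [y]. *)
  apply: jacobian_near; [exact: dYy | exact: differentiable_stage_sum |].
  by near=> z; apply: eqY; near: z; exact: open_nbhs_nbhs.
have -> : jacobian_matrix step y = (1%:M + \sum_(j < s)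
    jacobian (Y j) y *m (stage_hessian j (Y j y) *m B^T))^T.
  congr (_^T); rewrite eqstep; apply: etrans (jacobian_stage_sum _ dYy) _.
  by congr (_ + _); apply: eq_bigr => j _; rewrite scale1r.
rewrite trmxK.
exact: dirk_jacobian_preserves Bskew (fun j => stage_hessian_sym j _) eqA.
Unshelve. all: by end_near. Qed.

End OneStep.

Theorem theorem4p4
  (R : realType) (disp : measure_display) (T : measurableType disp)
  (P : probability T R) (d m s : nat)
  (B : 'M[R]_d) (B_skew : B^T = - B)
  (H : 'I_m.+1 -> 'rV[R]_d -> R) (H_smooth : forall l, smooth (H l))
  (W : 'I_m -> R -> {RV P >-> R}) (W_wiener : standard_wiener_process W)
  (b : 'I_m.+1 -> 'I_s -> R) (b_sum : forall l, \sum_(i < s) b l i = 1)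
  (h : R) (h_gt0 : 0 < h)
  (t : nat -> R) (t0_ge0 : 0 <= t 0%N) (t_step : forall k, t k.+1 = t k + h) :
  {ae P, forall w, forall k : nat,
    let J := fun r : 'I_m => W r (t k.+1) w - W r (t k) w in
    forall (U : set 'rV[R]_d) (Y : 'I_s -> 'rV[R]_d -> 'rV[R]_d),
      open U ->
      (forall y, U y -> dirk_stage_equations B H b h J y (Y ^~ y)) ->
      (forall i y, U y -> differentiable (Y i) y) ->
      let step := fun y => dirk_update B H b h J y (Y ^~ y) in
      forall y, U y ->
        jacobian_matrix step y *m B *m (jacobian_matrix step y)^T = B}.
Proof.
(* The identity is pathwise: it is proved for every outcome [w], with the increments as fixed real
   numbers. *)
apply: aeW => w k U Y oU stageY dY y Uy.
exact: dirk_step_poisson oU stageY dY Uy.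
Qed.
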